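(* Consider a controlled-type company in the market model described in the context, with liquidity of its stocks measured by the index $ILL_{s_0}(c_m,\lambda)$. An increase in the degree of noise traders' participation in trading (i.e. in $\lambda$) will enhance the liquidity of stocks generally in the market. Improvements of the corporate governance of the company (i.e. decreases of $c_m$) have the effect of increasing the liquidity of its stocks if $\lambda\neq0$.
   Context: Company. The governance parameter $c_m\in[0,1)$ is the largest share of profits that the controlling community (executives and controlling shareholders) can extract; smaller $c_m$ means better governance. In a controlled-type company the share actually extracted (the agency cost) is an exogenous constant $\rho_0\in[0,1)$ that does not change with $c_m$, and $c_m\ge\rho_0$. Let $\overline V>0$ be the value of a share to outside investors without agency cost, $V(\rho_0)=(1-\rho_0)\overline V$ its real (fair) value, and $\underline V=(1-c_m)\overline V$. Market. A shareholder must sell $M$ equal blocks of shares at time $T_2$ by open auction. There are $N_I\le M$ informed traders, each of whom estimates a share at $V(\rho_0)$. Noise traders willing to participate arrive as a Poisson process with rate $\lambda\ge0$ (the degree of noise traders' participation in trading), so the number $N_U$ of noise traders in the auction is Poisson with parameter $\lambda\Delta T$, where $\Delta T>0$ is the length of the time interval since the previous transactions. Noise traders' estimates of the share value are mutually independent (and independent of $N_U$) and uniform on $[\underline V,\overline V]$; noise traders do not know whether the company is of controlled type. Let $N=N_I+N_U$ and let $\widehat V^{(1)}\ge\dots\ge\widehat V^{(N)}$ be all estimates in descending order. The equilibrium market price after the $M$ deals is $P_{T_2}=\widehat V^{(M+1)}$ if $N>M$ and $P_{T_2}=\underline V$ if $N\le M$. Liquidity. For a constant $s_0\in[0,1)$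 let $F_{s_0}(c_m,\lambda)=\Pr[P_{T_2}<(1-s_0)V(\rho_0)]$, and let $ILL_{s_0}(c_m,\lambda)=-\ln F_{s_0}(c_m,\lambda)$ if $F_{s_0}(c_m,\lambda)>0$ and $ILL_{s_0}(c_m,\lambda)=+\infty$ if $F_{s_0}(c_m,\lambda)=0$. For fixed $s_0$, a greater $ILL_{s_0}$ means a higher level of liquidity.
   Formalization: Liquidity is shown non-decreasing always, and strictly increasing if the index is finite at the less liquid point and s_0>0 or ρ_0>0 (or, for governance, the smaller c_m is 0); in the remaining cases the index is constant, so strict increase is false there. *)

(* Defs.v *)
From HB Require Import structures.
From mathcomp Require Import all_boot all_order all_algebra finmap.
From mathcomp Require Import all_classical all_reals all_analysis.
Import Order.TTheory GRing.Theory Num.Theory.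
Import numFieldNormedType.Exports.

Set Implicit Arguments.
Unset Strict Implicit.
Unset Printing Implicit Defensive.

Local Open Scope classical_set_scope.
Local Open Scope ring_scope.

Definition mutually_independent d (T : measurableType d) (R : realType)
    (P : probability T R) (I : choiceType) (E : I -> set (set T)) : Prop :=
  forall (J : {fset I}) (A : I -> set T),
    (forall i, i \in J -> E i (A i)) ->
    P (\bigcap_(i in [set` J]) A i) = (\prod_(i <- J) P (A i))%E.

Definition generated_by d d' (T : measurableType d) (T' : measurableType d')
    (X : T -> T') : set (set T) :=
  preimage_set_system setT X measurable.

(* The library's [uniform_prob] needs a < b. The interval of estimates
   collapses to a point when c_m = 0; the uniform law is then a Dirac mass. *)
Definition uniform_law (R : realType) (a b : R) (mu : set R -> \bar R) : Prop :=
  (forall (ab : a < b) (A : set R), measurable A -> mu A = uniform_prob ab A) /\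
  (a = b -> forall A : set R, measurable A -> mu A = \d_a A).

(* Value of a share when the share [r] of profits is extracted:
   V(rho0) = share_value Vbar rho0, and the lower bound of the estimates is
   share_value Vbar c_m. *)
Definition share_value (R : realType) (Vbar r : R) : R := (1 - r) * Vbar.

(* Randomness of the auction. Only the first [N_U w] of the estimates
   [Vhat 0], [Vhat 1], ... are made by traders actually present in state [w].
   The second argument of the library's [poisson_prob] is unused there;
   [poisson_prob 0 _] is the Dirac mass at 0. *)
Record noise_market (R : realType) (Vbar dT c_m lambda : R) := NoiseMarket {
  market_display : measure_display ;
  state : measurableType market_display ;
  Pr : probability state R ;
  N_U : {RV Pr >-> nat} ;
  Vhat : nat -> {RV Pr >-> R} ;
  N_U_poisson : forall A : set nat,
    distribution Pr N_U A = poisson_prob (lambda * dT) 0%N A ;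
  Vhat_uniform : forall i : nat,
    uniform_law (share_value Vbar c_m) Vbar (distribution Pr (Vhat i)) ;
  (* Joint independence of N_U (index None) and all the estimates. *)
  market_independent : mutually_independent Pr
    (fun k : option nat =>
       if k is Some i then generated_by (Vhat i) else generated_by N_U) }.

Section liquidity.
Variables (R : realType) (M N_I : nat) (Vbar rho0 dT c_m lambda : R).
Variable mkt : noise_market Vbar dT c_m lambda.

Definition estimates (w : state mkt) : seq R :=
  nseq N_I (share_value Vbar rho0) ++ [seq Vhat mkt i w | i <- iota 0 (N_U mkt w)].

(* [nth] counts from 0, so index M is the (M+1)-st largest estimate. *)
Definition price (w : state mkt) : R :=
  let Vlow := share_value Vbar c_m in
  if (M < size (estimates w))%N then nth Vlow (sort >=%R (estimates w)) M
  else Vlow.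

Definition F (s0 : R) : R :=
  fine (Pr mkt [set w | price w < (1 - s0) * share_value Vbar rho0]).

Definition ILL (s0 : R) : \bar R :=
  if 0 < F s0 then (- ln (F s0))%:E else +oo%E.

End liquidity.

(* Main.v *)
(* By thinning, the number of noise traders whose estimate is at least
   (1 - s0) V(rho0) is Poisson with mean lambda dT q / c_m, where
   q = 1 - (1 - s0) (1 - rho0), and the price is below the threshold exactly
   when at most M - N_I of them are present. So F is a Poisson distribution
   function, strictly decreasing in its mean, if q < c_m; if c_m <= q all
   estimates reach the threshold and F = 0. *)
Require Import Defs.
From HB Require Import structures.
From mathcomp Require Import all_boot all_order all_algebra finmap.
From mathcomp Require Import all_classical all_reals all_analysis.
From mathcomp Require Import ring lra.
Import Order.TTheory GRing.Theory Num.Theory.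
Import numFieldNormedType.Exports.

Set Implicit Arguments.
Unset Strict Implicit.
Unset Printing Implicit Defensive.

Local Open Scope classical_set_scope.
Local Open Scope ring_scope.

(** * The Poisson distribution function and its monotonicity in the mean *)

Definition poisson_cdf (R : realType) (k : nat) (x : R) : R :=
  expR (- x) * \sum_(j < k.+1) exp_coeff x j.

Lemma is_derive_exp_coeff (R : realType) (x : R) n :
  is_derive x 1 (fun y => exp_coeff y n.+1) (exp_coeff x n).
Proof.
have n0 : n`!%:R != 0 :> R by rewrite pnatr_eq0 -lt0n fact_gt0.
have n1 : n.+1%:R != 0 :> R by rewrite pnatr_eq0.
rewrite (_ : (fun y => _) = (n.+1)`!%:R^-1 *: (@id R) ^+ n.+1); last first.
  by apply/funext => y; rewrite fctE /exp_coeff/= mulrC.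
apply: is_derive_eq.
rewrite /exp_coeff/= factS natrM /GRing.scale/=; field.
by apply/andP; split.
Qed.

(** Differentiation sends each exponential coefficient to the preceding one, so the derivative of
    the sum telescopes against that of [expR (- x)]; only the top term survives. *)
Lemma is_derive_poisson_cdf (R : realType) k (x : R) :
  is_derive x 1 (poisson_cdf k) (- (expR (- x) * exp_coeff x k)).
Proof.
elim: k => [|k IH].
  rewrite (_ : poisson_cdf 0 = expR \o -%R); last first.
    apply/funext => y /=; rewrite /poisson_cdf big_ord1 /exp_coeff/=.
    by rewrite expr0 fact0 divr1 mulr1.
  apply: is_derive_eq.
  by rewrite /exp_coeff/= expr0 fact0 divr1 mulr1 mulrN1.
rewrite (_ : poisson_cdf k.+1 =
    poisson_cdf k \+ (expR \o -%R) * (fun y => exp_coeff y k.+1)); last first.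
  by apply/funext => y; rewrite /poisson_cdf big_ord_recr/= mulrDr.
have D := is_derive_exp_coeff x k.
apply: is_derive_eq.
rewrite /= /GRing.scale/=; ring.
Qed.

Lemma poisson_cdf_decr (R : realType) k (x y : R) :
  0 <= x -> x < y -> poisson_cdf k y < poisson_cdf k x.
Proof.
move=> x0 xy.
have d (z : R) : derivable (poisson_cdf k) z 1.
  by have := is_derive_poisson_cdf k z; case.
(* For [x = 0] and [k > 0] the derivative vanishes at the left endpoint; its sign is required only
   at interior points, which are positive. *)
apply: (@ltr0_derive1_lt_cc R (poisson_cdf k) x y) => //.
- move=> z; rewrite in_itv/= => /andP[xz _]; rewrite derive1E.
  have -> := @derive_val _ _ _ _ _ _ _ (is_derive_poisson_cdf k z).
  have z0 : 0 < z by exact: le_lt_trans xz.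
  by rewrite oppr_lt0 mulr_gt0 ?expR_gt0// divr_gt0 ?exprn_gt0// ltr0n fact_gt0.
- apply: continuous_subspaceT => z.
  by apply: differentiable_continuous; exact/derivable1_diffP.
- by rewrite in_itv/= lexx ltW.
- by rewrite in_itv/= lexx ltW.
Qed.

Lemma poisson_cdf_gt0 (R : realType) k (x : R) : 0 <= x -> 0 < poisson_cdf k x.
Proof.
move=> x0; rewrite mulr_gt0 ?expR_gt0// big_ord_recl /exp_coeff/=.
rewrite expr0 fact0 divr1 ltr_pwDl// sumr_ge0// => i _.
by rewrite divr_ge0// exprn_ge0.
Qed.

(* [poisson_pmf] is [1] at rate [0], so the weights are written with
   [exp_coeff], which is also right there. *)
Lemma poisson_prob_set1 (R : realType) (mu : R) m n : 0 <= mu ->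
  poisson_prob mu m [set n] = (expR (- mu) * exp_coeff mu n)%:E.
Proof.
rewrite le_eqVlt => /predU1P[<-|mu0]; rewrite /poisson_prob ?ltxx.
  rewrite diracE oppr0 expR0 mul1r /exp_coeff/= expr0n.
  case: n => [|n]; first by rewrite mem_set// fact0 divr1.
  by rewrite memNset ?mul0r.
rewrite mu0 esum_set1 ?lee_fin ?poisson_pmf_ge0//.
by rewrite /poisson_pmf mu0 mulrC.
Qed.

(** * Thinning as an identity between series *)

Lemma nneseries_exp_coeff (R : realType) (x : R) : 0 <= x ->
  (\sum_(n <oo) (exp_coeff x n)%:E = (expR x)%:E)%E.
Proof.
move=> x0; rewrite /expR -EFin_lim; last exact: is_cvg_series_exp_coeff.
by apply/congr_lim/funext => n /=; rewrite sumEFin.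
Qed.

(** Substituting [n = i + j] splits each term into a factor in [j] and an exponential coefficient of
    [mu * (1 - p)]; summing over [i] yields [expR (mu * (1 - p))], which turns [expR (- mu)] into
    [expR (- (mu * p))]. *)
Lemma poisson_thinning_term (R : realType) (mu p : R) j :
  0 <= mu -> 0 <= p <= 1 ->
  (\sum_(n <oo) (expR (- mu) * exp_coeff mu n *
      ((p ^+ j * (1 - p) ^+ (n - j)) *+ 'C(n, j)))%:E =
   (expR (- (mu * p)) * exp_coeff (mu * p) j)%:E)%E.
Proof.
move=> mu0 /andP[p0 p1]; have q0 : 0 <= 1 - p by rewrite subr_ge0.
pose f n := (expR (- mu) * exp_coeff mu n *
  ((p ^+ j * (1 - p) ^+ (n - j)) *+ 'C(n, j)))%:E.
have f0 n : (0 <= f n)%E.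
  rewrite lee_fin; apply: mulr_ge0.
    by rewrite mulr_ge0 ?expR_ge0 ?exp_coeff_ge0.
  by rewrite mulrn_wge0// mulr_ge0 ?exprn_ge0.
(* The terms with [n < j] have a zero binomial coefficient, so the series may start at [j]. *)
rewrite (nneseries_split 0 j); last by move=> k _; exact: f0.
rewrite add0n big_nat big1 ?add0r; last first.
  by move=> n /andP[_ nj]; rewrite bin_small// mulr0n mulr0.
rewrite -(nneseries_addn _ f0) {f0}/f.
transitivity (\sum_(i <oo) ((expR (- mu) * exp_coeff (mu * p) j)%:E *
    (exp_coeff (mu * (1 - p)) i)%:E))%E.
  apply: eq_eseriesr => i _; rewrite -EFinM addnK; congr EFin.
  rewrite /exp_coeff/= !exprMn exprD.
  have := bin_fact (leq_addl i j); rewrite addnK.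
  move=> /(congr1 (GRing.natmul (1 : R))).
  rewrite !natrM => <-.
  have b0 : 'C(i + j, j)%:R != 0 :> R.
    by rewrite pnatr_eq0 -lt0n bin_gt0 leq_addl.
  have j0 : j`!%:R != 0 :> R by rewrite pnatr_eq0 -lt0n fact_gt0.
  have i0 : i`!%:R != 0 :> R by rewrite pnatr_eq0 -lt0n fact_gt0.
  rewrite -mulr_natr; field.
  by rewrite b0 j0 i0.
rewrite nneseriesZl; last first.
  by move=> i _; rewrite lee_fin exp_coeff_ge0// mulr_ge0.
rewrite nneseries_exp_coeff ?mulr_ge0// -EFinM mulrAC -expRD.
congr (expR _ * _)%:E.
ring.
Qed.

Lemma poisson_thinning (R : realType) (mu p : R) k :
  0 <= mu -> 0 <= p <= 1 ->
  (\sum_(n <oo) (expR (- mu) * exp_coeff mu n *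
      \sum_(j < k.+1) (p ^+ j * (1 - p) ^+ (n - j)) *+ 'C(n, j))%:E =
   (poisson_cdf k (mu * p))%:E)%E.
Proof.
move=> mu0 /[dup] p01 /andP[p0 p1]; have q0 : 0 <= 1 - p by rewrite subr_ge0.
under eq_eseriesr do rewrite mulr_sumr -sumEFin.
rewrite nneseries_sum; last first.
  move=> j n _; rewrite lee_fin; apply: mulr_ge0.
    by rewrite mulr_ge0 ?expR_ge0 ?exp_coeff_ge0.
  by rewrite mulrn_wge0// mulr_ge0 ?exprn_ge0.
rewrite /poisson_cdf mulr_sumr -sumEFin; apply: eq_bigr => j _.
exact: poisson_thinning_term.
Qed.

(** * Independence, and the number of estimates that reach a threshold *)

Lemma market_joint (R : realType) (Vbar dT c_m lambda : R)
    (mkt : noise_market Vbar dT c_m lambda) (C : set nat) n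
    (B : 'I_n -> set R) : (forall i, measurable (B i)) ->
  Pr mkt (N_U mkt @^-1` C `&` [set w | forall i : 'I_n, B i (Vhat mkt i w)]) =
  (Pr mkt (N_U mkt @^-1` C) * \prod_(i < n) Pr mkt (Vhat mkt i @^-1` B i))%E.
Proof.
move=> mB.
(* Independence is stated for events indexed by all of [option nat]; beyond [n] the family is padded
   with [setT]. *)
pose B' i := if insub i is Some j then B j else setT.
have B'E (j : 'I_n) : B' j = B j by rewrite /B' valK.
pose E k := if k is Some i then Vhat mkt i @^-1` B' i else N_U mkt @^-1` C.
pose s := None :: [seq Some (val i) | i <- enum 'I_n].
have us : uniq s.
  rewrite /= (map_comp Some val) map_inj_uniq; last by move=> ? ? [].
  rewrite map_inj_uniq ?enum_uniq ?andbT; last exact: val_inj.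
  by apply/mapP => -[].
(* The product over a finite set follows its internal enumeration; passing to [s] puts [None] first,
   so that the factor of [N_U] splits off. *)
have sJ : perm_eq (enum_fset [fset x in s]%fset) s.
  by apply: uniq_perm => // x; rewrite !inE.
have := @market_independent _ _ _ _ _ mkt [fset x in s]%fset E.
rewrite (perm_big _ sJ)/= big_cons big_map big_enum/=.
under eq_bigr do rewrite B'E.
move=> <-; last first.
  case=> [i|] _ /=; last by exists C => //; rewrite setTI.
  exists (B' i); last by rewrite setTI.
  by rewrite /B'; case: insub.
congr (Pr mkt _); apply/seteqP; split => w /=.
  move=> [NC Bw] k; rewrite /= !inE => /predU1P[->//|/mapP[i _ ->]] /=.
  by rewrite B'E; exact: Bw.
move=> Ew; split; first by apply: (Ew None); rewrite /= !inE.
move=> i; rewrite -B'E; apply: (Ew (Some (val i))).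
by rewrite /= !inE /=; apply/mapP; exists i => //; rewrite mem_enum.
Qed.

(** The event is the disjoint union, over index sets [S] of size at most [k], of the events that
    exactly the indices in [S] are hit. Each has a probability depending only on [#|S|], and
    ['C(n, j)] of the sets have size [j]. [A] will be the event that [n] noise traders are
    present. *)
Lemma binomial_count d (T : measurableType d) (R : realType)
    (P : probability T R) (A : set T) (D : nat -> set T) (p : R) n k :
  measurable A -> (forall i, measurable (D i)) ->
  (forall S : {set 'I_n},
    P (A `&` [set w | forall i : 'I_n, (w \in D i) = (i \in S)]) =
    (P A * (p ^+ #|S| * (1 - p) ^+ (n - #|S|))%:E)%E) ->
  measurable (A `&` [set w | (count (fun i => w \in D i) (iota 0 n) <= k)%N]) /\
  P (A `&` [set w | (count (fun i => w \in D i) (iota 0 n) <= k)%N]) =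
  (P A * (\sum_(j < k.+1) (p ^+ j * (1 - p) ^+ (n - j)) *+ 'C(n, j))%:E)%E.
Proof.
move=> mA mD hS.
pose U w := [set i : 'I_n | w \in D i]%SET.
have countE w : count (fun i => w \in D i) (iota 0 n) = #|U w|.
  rewrite -val_enum_ord count_map cardE -size_filter.
  rewrite /enum_mem -filter_predI; congr size.
  by apply: eq_filter => i; rewrite /= !inE andbT.
pose G (S : {set 'I_n}) :=
  A `&` [set w | forall i : 'I_n, (w \in D i) = (i \in S)].
(* Seen as fibres of the random hit set [U], the events [G S] are visibly disjoint. *)
have GE S : G S = A `&` (U @^-1` [set S]).
  congr (_ `&` _); apply/seteqP; split => w /=.
    by move=> h; apply/setP => i; rewrite inE.
  by move=> <- i; rewrite inE.
have mG S : measurable (G S).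
  apply: measurableI => //.
  rewrite (_ : mkset _ =
      \bigcap_(i in [set: 'I_n]) if i \in S then D i else ~` D i).
    apply: fin_bigcap_measurable; first exact: finite_finset.
    by move=> i _; case: ifP => // _; exact: measurableC.
  apply/seteqP; split => w /=.
    move=> h i _; rewrite -h; case: (boolP (w \in D i)); first exact: set_mem.
    by move=> /negP h2 /mem_set.
  move=> h i; have := h i I; case: ifP => _ ; first exact: mem_set.
  by move=> ?; apply: memNset.
pose Q := [set S : {set 'I_n} | (#|S| <= k)%N].
have -> : A `&` [set w | (count (fun i => w \in D i) (iota 0 n) <= k)%N] =
    \bigcup_(S in Q) G S.
  apply/seteqP; split => w /=.
    by move=> [Aw]; rewrite countE => Uk; exists (U w) => //; rewrite GE.
  by move=> [S Sk]; rewrite GE => -[Aw /= US]; split => //; rewrite countE US.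
have fQ : finite_set Q by exact: finite_finset.
split; first by apply: fin_bigcup_measurable.
rewrite measure_fin_bigcup//; last first.
  by move=> S S' _ _ [w []]; rewrite !GE /= => -[_ <-] [_ <-].
have -> : (\sum_(S \in Q) P (G S) =
    \sum_(S : {set 'I_n} | (#|S| <= k)%N) P (G S))%E.
  rewrite -(@bigfs _ _ _ _ (enum {: {set 'I_n}})
    (fun S : {set 'I_n} => (#|S| <= k)%N)).
  - by rewrite big_enum_cond.
  - exact: enum_uniq.
  - by move=> S _; rewrite mem_enum.
under eq_bigr do rewrite hS.
have PA : P A \is a fin_num by rewrite fin_num_measure.
rewrite -(fineK PA); under eq_bigr do rewrite -EFinM.
rewrite sumEFin -EFinM -mulr_sumr; congr (_ * _)%:E.
(* The sets are grouped by size; [inord] is faithful because only sizes at most [k] occur. *)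
rewrite (partition_big (fun S : {set 'I_n} => inord #|S| : 'I_k.+1) xpredT)//=.
apply: eq_bigr => j _.
rewrite (eq_big (fun S : {set 'I_n} => #|S| == j)
  (fun _ => p ^+ j * (1 - p) ^+ (n - j))); last first.
- by move=> S /andP[Sk /eqP <-]; rewrite inordK.
- move=> S; apply/andP/eqP => [[Sk /eqP <-]|Sj]; first by rewrite inordK.
  rewrite Sj -ltnS ltn_ord; split => //.
  by apply/eqP/val_inj; rewrite /= inordK.
rewrite sumr_const; congr (_ *+ _).
by rewrite -[in RHS](card_ord n) -card_draws; apply: eq_card => S; rewrite !inE.
Qed.

(** * Order statistics and the auction price *)

(** In a descending list the entries reaching [t] form a prefix, and sorting does not change their
    number. *)
Lemma sort_nth_lt (R : realDomainType) (x0 t : R) (s : seq R) (M : nat) :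
  (M < size s)%N ->
  (nth x0 (sort >=%R s) M < t) = (count (fun x => (t <= x)%R) s <= M)%N.
Proof.
move=> Ms; have /permP/(_ (fun x => t <= x)) <- := permEl (perm_sort >=%R s).
have ss : sorted >=%R (sort >=%R s) by apply: sort_sorted => x y; exact: le_total.
move: Ms; rewrite -(size_sort >=%R s); set r := sort _ s => Mr.
have nth_ge i j : (i <= j)%N -> (j < size r)%N -> nth x0 r j <= nth x0 r i.
  move=> ij jr; apply: (sorted_leq_nth _ _ x0 ss) => //.
  - by move=> y x z /= yx zy; exact: le_trans zy yx.
  - by move=> x /=.
  - by rewrite inE (leq_ltn_trans ij).
have [lt_t|le_t] := ltP.
  rewrite -(cat_take_drop M r) count_cat.
  have -> : count (fun x => t <= x) (drop M r) = 0%N.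
    apply/eqP; rewrite -leqn0 leqNgt -has_count; apply/hasPn => x.
    move=> /(nthP x0)[i]; rewrite size_drop nth_drop => ir <-.
    rewrite -ltNge (le_lt_trans _ lt_t)// nth_ge ?leq_addr//.
    by rewrite -ltn_subRL.
  by rewrite addn0 (leq_trans (count_size _ _))// size_take Mr.
(* Here entry [M] reaches [t], hence so do all of the first [M.+1] entries. *)
apply/esym/negbTE; rewrite -ltnNge -(cat_take_drop M.+1 r) count_cat.
have /eqP -> : count (fun x => t <= x) (take M.+1 r) == size (take M.+1 r).
  rewrite -all_count; apply/allP => x /(nthP x0)[i].
  rewrite size_takel// => iM; rewrite nth_take// => <-.
  by rewrite (le_trans le_t)// nth_ge.
by rewrite size_takel// leq_addr.
Qed.

(** All [N_I] informed estimates reach [t], which leaves room for [M - N_I] noise estimates. The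
    second conjunct handles the default price: with too few traders the count bound is automatic,
    and everything depends on whether the lower bound itself is below [t]. *)
Lemma price_lt (R : realType) (M N_I : nat) (Vbar rho0 dT c_m lambda t : R)
    (mkt : noise_market Vbar dT c_m lambda) (w : state mkt) :
  (N_I <= M)%N -> t <= share_value Vbar rho0 ->
  (price M N_I rho0 w < t) =
  (count (fun i => (t <= Vhat mkt i w)%R) (iota 0 (N_U mkt w)) <= M - N_I)%N &&
  ((M - N_I < N_U mkt w)%N || (share_value Vbar c_m < t)).
Proof.
move=> NM tV; rewrite /price.
have szE : size (estimates N_I rho0 w) = (N_I + N_U mkt w)%N.
  by rewrite size_cat size_nseq size_map size_iota.
have cE : count (fun x => t <= x) (estimates N_I rho0 w) =
    (N_I + count (fun i => (t <= Vhat mkt i w)%R) (iota 0 (N_U mkt w)))%N.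
  by rewrite count_cat count_nseq tV mul1n count_map.
case: ifPn => [Ms|].
  rewrite sort_nth_lt// cE leq_subRL//.
  by move: Ms; rewrite szE ltn_subLR// => ->; rewrite andbT.
rewrite szE -leqNgt => Ms.
rewrite ltn_subLR// ltnNge Ms/= leq_subRL//.
rewrite (leq_trans _ Ms)//= leq_add2l (leq_trans (count_size _ _))//.
by rewrite size_iota.
Qed.

(** * The law of one estimate, and closed forms for [F] and [ILL] *)

(** The value 1 also covers the collapsed interval, since [a = b] forces [t <= a]. *)
Lemma uniform_law_ge (R : realType) (a b t : R) (mu : set R -> \bar R) :
  a <= b -> t <= b -> uniform_law a b mu ->
  mu `[t, +oo[%classic = (if a < t then (b - t) / (b - a) else 1)%:E.
Proof.
move=> + tb [mulaw mudirac].
rewrite le_eqVlt => /predU1P[ab|ab].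
  rewrite mudirac// ab ltNge tb/= diracE mem_set//=.
  by rewrite in_itv/= tb.
rewrite (mulaw ab)//= /uniform_prob; case: ltP => at_; last first.
  rewrite integral_uniform_pdf1// => x; rewrite /= !in_itv/= andbT.
  by move=> /andP[ax _]; exact: le_trans ax.
rewrite integral_uniform_pdf.
have -> : `[t, +oo[ `&` `[a, b] = `[t, b]%classic.
  apply/seteqP; split => x; rewrite /= !in_itv/= ?andbT.
    by move=> [-> /andP[]].
  by move=> /andP[tx ->]; rewrite tx (le_trans (ltW at_) tx).
rewrite (eq_integral (fun=> (b - a)^-1%:E)); last first.
  move=> x; rewrite inE/= in_itv/= /uniform_pdf => /andP[tx ->].
  by rewrite (le_trans (ltW at_) tx).
rewrite integral_cst//= lebesgue_measure_itv/= lte_fin.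
case: ltP => tb'; first by rewrite -EFinD -EFinM mulrC.
by rewrite mule0 (le_anti (introT andP (conj tb tb'))) subrr mul0r.
Qed.

Lemma F_poisson_cdf (R : realType) (M N_I : nat)
    (Vbar rho0 dT c_m lambda s0 : R)
    (mkt : noise_market Vbar dT c_m lambda) (q := 1 - (1 - s0) * (1 - rho0)) :
  (N_I <= M)%N -> 0 < Vbar -> 0 <= lambda * dT -> 0 <= c_m ->
  0 <= s0 -> rho0 <= 1 -> 0 <= q ->
  F M N_I rho0 mkt s0 =
  if q < c_m then poisson_cdf (M - N_I) (lambda * dT * (q / c_m)) else 0.
Proof.
move=> NM V0 mu0 c0 s00 rho1 q0; rewrite /F.
set k := (M - N_I)%N; set t := (1 - s0) * _; set mu := lambda * dT.
set a := share_value Vbar c_m.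
have tE : t = (1 - q) * Vbar by rewrite /t /q /share_value; ring.
have tV : t <= share_value Vbar rho0.
  by rewrite /t ler_piMl ?gerBl// mulr_ge0 ?subr_ge0// ltW.
have at_ : (a < t) = (q < c_m).
  by rewrite tE /a /share_value ltr_pM2r// ltrD2l ltrN2.
have ab : a <= Vbar by rewrite /a /share_value ler_piMl ?gerBl// ltW.
have tb : t <= Vbar by rewrite tE ler_piMl ?gerBl// ltW.
(* The chance that one estimate reaches [t]: the gap [Vbar - t] is [q * Vbar], and the interval of
   estimates has length [c_m * Vbar]. *)
set p := if q < c_m then q / c_m else 1.
have pE i : Pr mkt (Vhat mkt i @^-1` `[t, +oo[) = p%:E.
  have := uniform_law_ge ab tb (Vhat_uniform mkt i).
  rewrite /distribution /pushforward => ->; rewrite at_ /p; case: ifPn => // qc; congr EFin.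
  have cn0 : c_m != 0 by rewrite gt_eqF// (le_lt_trans q0).
  rewrite tE /a /share_value; field.
  have -> : Vbar - (1 - c_m) * Vbar = c_m * Vbar by ring.
  by rewrite cn0 mulf_neq0// gt_eqF.
pose D i := Vhat mkt i @^-1` `[t, +oo[.
have mD i : measurable (D i) by exact: measurable_funPTI.
have pC i : Pr mkt (Vhat mkt i @^-1` `]-oo, t[) = (1 - p)%:E.
  rewrite -setCitvr preimage_setC probability_setC ?pE//.
  exact: (mD i).
have p01 : 0 <= p <= 1.
  rewrite /p; case: ifPn => [qc|_]; last by rewrite ler01 lexx.
  have c1 : 0 < c_m by exact: le_lt_trans qc.
  by rewrite divr_ge0// ?ler_pdivrMr// mul1r ltW.
have DE w i : (w \in D i) = (t <= Vhat mkt i w).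
  by apply/idP/idP; rewrite inE /D/= in_itv/= andbT.
pose A n := N_U mkt @^-1` [set n].
have mA n : measurable (A n) by exact: measurable_funPTI.
pose H n := A n `&` [set w | (count (fun i => w \in D i) (iota 0 n) <= k)%N].
have [mH PH] : (forall n, measurable (H n)) /\ (forall n, Pr mkt (H n) =
    (Pr mkt (A n) *
      (\sum_(j < k.+1) (p ^+ j * (1 - p) ^+ (n - j)) *+ 'C(n, j))%:E)%E).
  apply: all_and2 => n; apply: binomial_count => // S.
  (* That exactly the traders in [S] reach [t] amounts to one half-line condition per trader, so
     independence applies. *)
  pose B (i : 'I_n) : set R :=
    if i \in S then `[t, +oo[%classic else `]-oo, t[%classic.
  have := @market_joint _ _ _ _ _ mkt [set n] n B.
  rewrite (_ : [set w | _] = [set w | forall i : 'I_n, (w \in D i) = (i \in S)]).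
    move=> ->; last by move=> i; rewrite /B; case: ifP.
    congr (_ * _)%E.
    rewrite (eq_bigr (fun i => (if i \in S then p else 1 - p)%:E)); last first.
      by move=> i _; rewrite /B; case: ifP.
    rewrite prodEFin; congr EFin.
    rewrite (bigID (mem S))/=; congr (_ * _).
      by rewrite (eq_bigr (fun=> p)) ?prodr_const// => i ->.
    rewrite (eq_bigr (fun=> 1 - p)); last by move=> i /negbTE ->.
    rewrite prodr_const; congr (_ ^+ _).
    have := cardC (mem S); rewrite card_ord => /(congr1 (subn^~ #|S|)).
    by rewrite addKn.
  apply/seteqP; split => w /= h i; have := h i;
    rewrite DE /B; case: ifP => _; rewrite /= in_itv/= ?andbT//.
  - by move=> /lt_geF.
  - by move=> /negbT; rewrite -ltNge.
(* If [c_m <= q], the default price is not below [t], so the states with [n <= k] must be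
   dropped. *)
pose H' n := if (k < n)%N || (q < c_m) then H n else set0.
have -> : [set w | price M N_I rho0 w < t] = \bigcup_n H' n.
  apply/seteqP; split => w /=; rewrite price_lt// at_.
    move=> /andP[h1 h2]; exists (N_U mkt w) => //; rewrite /H' h2; split => //=.
    by rewrite (eq_count (DE w)).
  move=> [n _]; rewrite /H'; case: ifPn => // h2 [/= -> ].
  by rewrite (eq_count (DE w)) => ->.
have mH' n : measurable (H' n) by rewrite /H'; case: ifP.
rewrite measure_semi_bigcup//; last 2 first.
- move=> i j _ _ [w [+ +]]; rewrite /H'.
  by case: ifP => // _ [/= <- _]; case: ifP => // _ [/= <-].
- exact: bigcup_measurable.
have PA n : Pr mkt (A n) = (expR (- mu) * exp_coeff mu n)%:E.
  have := N_U_poisson mkt [set n]; rewrite /distribution /pushforward => ->.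
  exact: poisson_prob_set1.
(* If [c_m <= q], then [p = 1], and only [n > k] remains; each binomial term contains [0 ^+ (n - j)]
   with [j <= k < n] and vanishes. *)
case: ifPn => qc; last first.
  rewrite eseries0 ?fine0// => n _ _; rewrite /H' (negbTE qc) orbF.
  case: ifPn => [kn|_]; last exact: measure0.
  apply: etrans (PH n) _; rewrite big1 ?mule0// => j _.
  rewrite /p (negbTE qc) subrr expr0n subn_eq0.
  by rewrite leqNgt (leq_trans (ltn_ord j))// mulr0 mul0rn.
have -> : q / c_m = p by rewrite /p qc.
rewrite -[RHS]/(fine (poisson_cdf k (mu * p))%:E) -poisson_thinning//.
congr fine; apply: eq_eseriesr => n _.
by rewrite /H' qc orbT; apply: etrans (PH n) _; rewrite PA -EFinM.
Qed.

Lemma ILL_poisson_cdf (R : realType) (M N_I : nat)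
    (Vbar rho0 dT c_m lambda s0 : R)
    (mkt : noise_market Vbar dT c_m lambda) (q := 1 - (1 - s0) * (1 - rho0)) :
  (N_I <= M)%N -> 0 < Vbar -> 0 <= lambda * dT -> 0 <= c_m ->
  0 <= s0 -> rho0 <= 1 -> 0 <= q ->
  ILL M N_I rho0 mkt s0 =
  if q < c_m then (- ln (poisson_cdf (M - N_I) (lambda * dT * (q / c_m))))%:E
  else +oo%E.
Proof.
move=> NM V0 mu0 c0 s00 rho1 q0; rewrite /ILL F_poisson_cdf// -/q.
case: (q < c_m); last by rewrite ltxx.
by rewrite poisson_cdf_gt0// mulr_ge0// divr_ge0.
Qed.

(** * Comparative statics in [lambda] and [c_m] *)

Lemma ln_poisson_cdf_lt (R : realType) k (x y : R) : 0 <= x -> x < y ->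
  - ln (poisson_cdf k x) < - ln (poisson_cdf k y).
Proof.
move=> x0 xy; have y0 := le_trans x0 (ltW xy).
by rewrite ltrN2 ltr_ln ?posrE ?poisson_cdf_gt0// poisson_cdf_decr.
Qed.

(** Strictness is claimed only where the smaller index is finite. If [s0 = rho0 = 0], the threshold
    is [Vbar] and [q = 0]: for positive [c_m] the mean is 0 and the index is constant, while at
    [c_m = 0] it jumps to [+oo], whence the alternative [c1 == 0]. *)
Theorem proposition7 (R : realType) (M N_I : nat) (Vbar rho0 dT s0 : R)
    (hNI : (N_I <= M)%N) (hV : 0 < Vbar) (hrho : 0 <= rho0 < 1) (hdT : 0 < dT)
    (hs0 : 0 <= s0 < 1) :
  (forall (c_m lambda1 lambda2 : R)
      (mkt1 : noise_market Vbar dT c_m lambda1)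
      (mkt2 : noise_market Vbar dT c_m lambda2),
      rho0 <= c_m < 1 -> 0 <= lambda1 -> lambda1 < lambda2 ->
      (ILL M N_I rho0 mkt1 s0 <= ILL M N_I rho0 mkt2 s0)%E /\
      ((ILL M N_I rho0 mkt1 s0 < +oo)%E -> (0 < s0) || (0 < rho0) ->
       (ILL M N_I rho0 mkt1 s0 < ILL M N_I rho0 mkt2 s0)%E)) /\
  (forall (c1 c2 lambda : R)
      (mkt1 : noise_market Vbar dT c1 lambda)
      (mkt2 : noise_market Vbar dT c2 lambda),
      rho0 <= c1 -> c1 < c2 -> c2 < 1 -> 0 <= lambda -> lambda != 0 ->
      (ILL M N_I rho0 mkt2 s0 <= ILL M N_I rho0 mkt1 s0)%E /\
      ((ILL M N_I rho0 mkt2 s0 < +oo)%E ->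
       [|| 0 < s0, 0 < rho0 | c1 == 0] ->
       (ILL M N_I rho0 mkt2 s0 < ILL M N_I rho0 mkt1 s0)%E)).
Proof.
have [rho_ge0 rho_lt1] := andP hrho; have [s_ge0 s_lt1] := andP hs0.
pose q := 1 - (1 - s0) * (1 - rho0).
have q0 : 0 <= q by rewrite /q; nra.
have qgt0 : (0 < s0) || (0 < rho0) -> 0 < q by rewrite /q => /orP[] ?; nra.
have rho_le1 := ltW rho_lt1.
split=> [c l1 l2 mkt1 mkt2 /andP[rc c1] l10 l12
  |c1 c2 l mkt1 mkt2 rc1 c12 c21 l0 ln0].
  have l20 : 0 <= l2 by rewrite (le_trans l10)// ltW.
  have c0 : 0 <= c by exact: le_trans rc.
  rewrite !ILL_poisson_cdf// ?mulr_ge0// ?(ltW hdT)// -/q.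
  case: ifPn => [qc|_]; last by rewrite lexx ltxx.
  have cgt0 : 0 < c by exact: le_lt_trans qc.
  have strict : 0 < q ->
      (- ln (poisson_cdf (M - N_I) (l1 * dT * (q / c))) <
       - ln (poisson_cdf (M - N_I) (l2 * dT * (q / c)))).
    move=> qpos; apply: ln_poisson_cdf_lt.
      by rewrite !mulr_ge0 ?invr_ge0// ltW.
    by rewrite ltr_pM2r ?divr_gt0// ltr_pM2r.
  rewrite lee_fin lte_fin; split; last by move=> _ /qgt0.
  (* For [q = 0] both means are 0 and the indices agree. *)
  move: q0; rewrite le_eqVlt => /predU1P[<-|/strict/ltW//].
  by rewrite mul0r !mulr0.
have c10 : 0 <= c1 by exact: le_trans rc1.
have c2gt0 : 0 < c2 by exact: le_lt_trans c12.
have lgt0 : 0 < l * dT by rewrite mulr_gt0// lt0r ln0.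
rewrite !ILL_poisson_cdf// ?(ltW lgt0)// ?(ltW c2gt0)// -/q.
(* If [c1 <= q], the better governed company has index [+oo], and finiteness of the other index is
   already the strict inequality. This includes [c1 = 0]. *)
have [qc1|c1q] := ltP q c1; last first.
  by rewrite leey; split.
have c1gt0 : 0 < c1 by exact: le_lt_trans qc1.
rewrite (lt_trans qc1 c12).
have strict : 0 < q ->
    (- ln (poisson_cdf (M - N_I) (l * dT * (q / c2))) <
     - ln (poisson_cdf (M - N_I) (l * dT * (q / c1)))).
  move=> qpos; apply: ln_poisson_cdf_lt.
    by rewrite !mulr_ge0 ?invr_ge0// ltW.
  by rewrite ltr_pM2l// ltr_pM2l// ltf_pV2.
rewrite lee_fin lte_fin; split; last first.
  by move=> _; rewrite (gt_eqF c1gt0) orbF => /qgt0.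
move: q0; rewrite le_eqVlt => /predU1P[<-|/strict/ltW//].
by rewrite !mul0r !mulr0.
Qed.
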